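(* Let $n\geq 1$ and let $D$ be a locally countable Borel directed graph in which every vertex has out-degree at most $n$. Then either $\chi_B(\tilde{D})=\infty$ or $\chi_B(\tilde{D})\leq \frac{(n+1)(n+2)}{2}$, where $\tilde{D}$ is the underlying graph of $D$.
   Context: A directed graph $D$ consists of a vertex set $V(D)$ and an irreflexive relation $A(D)\subseteq V(D)\times V(D)$ of arcs; it is a Borel directed graph if $V(D)$ is a standard Borel space and $A(D)$ is Borel in $V(D)\times V(D)$. The out-degree of $x$ is the number of $y$ with $(x,y)\in A(D)$. The underlying graph $\tilde{D}$ has the same vertices, with $x,y$ adjacent iff $(x,y)\in A(D)$ or $(y,x)\in A(D)$. $D$ is locally countable if every vertex has countably many neighbours in $\tilde{D}$. The Borel chromatic number $\chi_B(\tilde{D})$ is the least $k$ such that there is a Borel proper coloring $c:V(D)\to\{0,\dots,k-1\}$ of $\tilde{D}$ ($\infty$ if none exists for finite $k$). *)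

(* Defs.v *)
From HB Require Import structures.
From mathcomp Require Import all_boot all_order all_algebra.
From mathcomp Require Import all_classical all_reals all_analysis.

Set Implicit Arguments.
Unset Strict Implicit.
Unset Printing Implicit Defensive.

Import Order.TTheory GRing.Theory Num.Theory.

Local Open Scope classical_set_scope.
Local Open Scope ring_scope.

(* Sigma-algebras are explicit families of sets rather than [measurableType]
   structures: the latter are pointed and would exclude the empty graph. *)

Definition polish_metric (R : realType) (M : metricType R) : Prop :=
  (forall u : nat -> M, cauchy (u @ \oo) -> exists l : M, u @ \oo --> l) /\
  (exists2 Q : set M, countable Q & dense Q).

(* [(V, S)] is isomorphic, as a measurable space, to a Polish space with its
   Borel sigma-algebra. *)
Definition standard_borel (R : realType) (V : Type) (S : set (set V)) : Prop :=
  exists (M : metricType R) (f : V -> M),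
    [/\ polish_metric M, bijective f &
        S = [set f @^-1` B | B in <<s (@open M) >>]].

Definition prod_sigma_algebra (V W : Type) (S : set (set V)) (S' : set (set W)) :
    set (set (V * W)) :=
  <<s [set A `*` B | A in S & B in S'] >>.

Record digraph (V : Type) := Digraph {
  arcs : set (V * V);
  arcs_irreflexive : forall x, ~ arcs (x, x)
}.

Section Digraph.
Variables (V : Type) (D : digraph V).

Definition borel_digraph (S : set (set V)) : Prop :=
  prod_sigma_algebra S S (arcs D).

Definition out_neighbours (x : V) : set V := [set y | arcs D (x, y)].

Definition underlying (x y : V) : Prop := arcs D (x, y) \/ arcs D (y, x).

Definition locally_countable : Prop :=
  forall x, countable [set y | underlying x y].

Definition out_degree_le (n : nat) : Prop :=
  forall x, (out_neighbours x #<= `I_n)%card.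

End Digraph.

Section BorelChromaticNumber.
Variables (V : Type) (S : set (set V)) (adj : V -> V -> Prop).

Definition borel_colorable (k : nat) : Prop :=
  exists c : V -> 'I_k,
    (forall Y : set 'I_k, S (c @^-1` Y)) /\
    (forall x y, adj x y -> c x <> c y).

Definition borel_chromatic_number (R : realType) : \bar R :=
  match pselect (exists k, `[< borel_colorable k >]) with
  | left colorable => (ex_minn colorable)%:R%:E
  | right _ => +oo%E
  end.

End BorelChromaticNumber.

(* Main.v *)
Require Import Defs.
From mathcomp Require Import all_boot all_order all_algebra.
From mathcomp Require Import all_classical all_reals all_analysis.
From mathcomp Require Import zify.
From mathcomp Require Import lra.

(** Fix a finite Borel proper colouring c and call an arc x -> y forward if
    c x < c y and backward if c y < c x. Both kinds of arcs form a digraph of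
    bounded height, so going along the height each vertex x can be given a number
    hf x, the least number not used by its forward out-neighbours, and likewise
    hb x for the backward ones. The colouring x |-> (hf x, hb x) is proper, and
    since hf x and hb x are at most the numbers of forward and backward arcs
    leaving x, hf x + hb x <= n, which leaves (n + 1)(n + 2) / 2 colours.

    These colourings are Borel because { x | exists y in B, x -> y } is Borel for
    every Borel B: a projection of a Borel set with finite sections of bounded
    size is Borel. This is derived from Lusin's separation theorem for analytic
    sets, after coding points of the standard Borel space by those of a Borel
    subset of the Cantor space. *)

Set Implicit Arguments.
Unset Strict Implicit.
Unset Printing Implicit Defensive.

Import Order.TTheory GRing.Theory Num.Theory.

Local Open Scope classical_set_scope.
Local Open Scope ring_scope.

(** * Closure of sigma-algebras under countable logical operations *)

Section SigmaAlgebra.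
Variables (T : Type) (S : set (set T)) (hS : sigma_algebra setT S).

Lemma sa_not (A : set T) : S A -> S [set x | ~ A x].
Proof. by case: hS => _ + _ => /[apply]; rewrite setTD. Qed.

Lemma sa_ex (I : countType) (F : I -> set T) :
  (forall i, S (F i)) -> S [set x | exists i, F i x].
Proof.
case: hS => S0 _ SU SF.
pose G n := if unpickle n is Some i then F i else set0.
have -> : [set x | exists i, F i x] = \bigcup_n G n.
  apply/seteqP; split => x /=.
    by case=> i Fi; exists (pickle i) => //; rewrite /G pickleK.
  by case=> n _; rewrite /G; case: unpickle => // i Fi; exists i.
by apply: SU => n; rewrite /G; case: unpickle.
Qed.

Lemma sa_all (I : countType) (F : I -> set T) :
  (forall i, S (F i)) -> S [set x | forall i, F i x].
Proof.
move=> SF; have := sa_not (sa_ex (fun i => sa_not (SF i))).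
congr S; apply/seteqP; split => x /=.
  by move=> nF i; apply: contrapT => nFi; apply: nF; exists i.
by move=> Fx [i]; apply.
Qed.

Lemma sa_prop (P : Prop) : S [set _ | P].
Proof.
have S0 : S set0 by case: hS.
have [p|np] := pselect P.
  have := sa_not S0; congr S; apply/seteqP; split => // x _ /=; exact.
by move: S0; congr S; apply/seteqP; split.
Qed.

Lemma sa_and (A B : set T) : S A -> S B -> S [set x | A x /\ B x].
Proof.
move=> SA SB; have := @sa_all bool (fun b => if b then A else B).
have -> : [set x | forall b : bool, (if b then A else B) x] =
          [set x | A x /\ B x].
  apply/seteqP; split => x /=; last by case=> ? ? [].
  by move=> AB; split; [exact: (AB true)|exact: (AB false)].
by apply; case.
Qed.

Lemma sa_or (A B : set T) : S A -> S B -> S [set x | A x \/ B x].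
Proof.
move=> SA SB; have := sa_not (sa_and (sa_not SA) (sa_not SB)).
congr S; apply/seteqP; split => x /=.
  by move=> nAB; apply: contrapT => /not_orP[? ?]; exact: nAB.
by move=> [Ax [/(_ Ax)]|Bx [_ /(_ Bx)]].
Qed.

Lemma sa_imp (P : Prop) (A : set T) : (P -> S A) -> S [set x | P -> A x].
Proof.
have [p /(_ p)|np _] := pselect P.
  by congr S; apply/seteqP; split => x /=; [move=> ? _|apply].
by have := sa_prop True; congr S; apply/seteqP; split => x //= _ /np.
Qed.

End SigmaAlgebra.

Lemma sigma_algebra_preimages (T U : Type) (S : set (set U)) (f : T -> U) :
  sigma_algebra setT S -> sigma_algebra setT [set f @^-1` B | B in S].
Proof.
move=> hS; split.
- by exists set0; [case: hS|rewrite preimage_set0].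
- move=> _ [B SB <-]; exists (~` B); last by rewrite setTD preimage_setC.
  exact: (sa_not hS).
- move=> A SA.
  have /choice[B SB] : forall k, exists B, S B /\ f @^-1` B = A k.
    by move=> k; have [B ? ?] := SA k; exists B.
  exists (\bigcup_k B k); first by case: hS => _ _; apply => k; case: (SB k).
  by rewrite preimage_bigcup; apply: eq_bigcup => // k _; case: (SB k).
Qed.

(** * Borel sets of the Cantor space *)

Notation cantor := (nat -> bool)%type.

Definition borel : set (set cantor) := <<s [set [set x : cantor | x k] | k in setT] >>.

Lemma borel_sigma_algebra : sigma_algebra setT borel.
Proof. exact: smallest_sigma_algebra. Qed.

Lemma borel_coord k : borel [set x : cantor | x k].
Proof. by apply: sub_sigma_algebra; exists k. Qed.

Lemma borel_coord_eq k b : borel [set x | x k = b].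
Proof.
case: b; first exact: borel_coord.
have := sa_not borel_sigma_algebra (borel_coord k).
by congr borel; apply/seteqP; split => x /=; [move/negP/negbTE|move=> ->].
Qed.

Lemma borel_preimage (T : Type) (S : set (set T)) (f : T -> cantor) :
  sigma_algebra setT S -> (forall k, S [set t | f t k]) ->
  forall E, borel E -> S (f @^-1` E).
Proof.
move=> hS Sf E bE.
suff : borel `<=` [set E | S (f @^-1` E)] by apply.
apply: smallest_sub => [|_ [k _ <-]]; last exact: Sf.
split=> [|A|A] /=.
- by rewrite preimage_set0; case: hS.
- by rewrite setTD preimage_setC; exact: sa_not.
- by move=> SA; rewrite preimage_bigcup; case: hS => _ _; apply.
Qed.

(** Interleaving codes a pair of points by one point, so that subsets of the plane are again subsets
    of [cantor]. *)
Definition join (x y : cantor) : cantor :=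
  fun i => if odd i then y i./2 else x i./2.

Definition evens (z : cantor) : cantor := fun i => z i.*2.
Definition odds (z : cantor) : cantor := fun i => z i.*2.+1.

Lemma evens_join x y : evens (join x y) = x.
Proof. by apply/funext => i; rewrite /evens /join odd_double doubleK. Qed.

Lemma odds_join x y : odds (join x y) = y.
Proof.
by apply/funext => i; rewrite /odds /join /= odd_double /= uphalf_double.
Qed.

Lemma borel_join (T : Type) (S : set (set T)) (f g : T -> cantor) (E : set cantor) :
  sigma_algebra setT S -> (forall k, S [set t | f t k]) ->
  (forall k, S [set t | g t k]) -> borel E -> S [set t | E (join (f t) (g t))].
Proof.
move=> hS Sf Sg bE; apply: (borel_preimage (f := fun t => join (f t) (g t)) hS) => // k.
by rewrite /join; case: odd.
Qed.

Definition proj (E : set cantor) : set cantor := [set x | exists y, E (join x y)].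

(** * Analytic sets *)

Definition agree (T : Type) (N : nat) (f g : nat -> T) :=
  forall i, (i < N)%N -> f i = g i.

(** Closedness in the product of the Cantor and Baire spaces, expressed through finite initial
    segments. *)
Definition closed_rel (K : cantor -> (nat -> nat) -> Prop) :=
  forall x s, (forall N, exists x' s', [/\ agree N x x', agree N s s' & K x' s']) ->
  K x s.

Definition analytic (P : set cantor) :=
  exists2 K, closed_rel K & P = [set x | exists s, K x s].

Lemma agree_le (T : Type) N M (f g : nat -> T) :
  (N <= M)%N -> agree M f g -> agree N f g.
Proof. by move=> NM fg i iN; apply: fg; exact: leq_trans NM. Qed.

Lemma analytic_coord_eq k b : analytic [set x | x k = b].
Proof.
exists (fun x _ => x k = b).
  by move=> x s /(_ k.+1)[x' [s' [-> //]]].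
by apply/seteqP; split => x /= [] //; exists id.
Qed.

Lemma analytic_ex (F : nat -> set cantor) :
  (forall i, analytic (F i)) -> analytic [set x | exists i, F i x].
Proof.
move=> aF.
have /choice[K KF] : forall i, exists K, closed_rel K /\ F i = [set x | exists s, K x s].
  by move=> i; have [K ? ?] := aF i; exists K.
(* The first entry of [s] names the index, the rest is a witness for it. *)
exists (fun x s => K (s 0%N) x (fun i => s i.+1)).
  move=> x s cl; apply: (KF _).1 => N; have [x' [s' [xx' ss' Ks']]] := cl N.+1.
  exists x', (fun i => s' i.+1); split.
  - exact: agree_le xx'.
  - by move=> i iN; exact: ss'.
  - by rewrite ss'.
apply/seteqP; split => x /=.
  case=> i; rewrite (KF i).2 /= => -[s Ks].
  by exists (fun k => if k is k'.+1 then s k' else i).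
by case=> s Ks; exists (s 0%N); rewrite (KF _).2; eexists; exact: Ks.
Qed.

Lemma analytic_all (F : nat -> set cantor) :
  (forall i, analytic (F i)) -> analytic [set x | forall i, F i x].
Proof.
move=> aF.
have /choice[K KF] : forall i, exists K, closed_rel K /\ F i = [set x | exists s, K x s].
  by move=> i; have [K ? ?] := aF i; exists K.
exists (fun x s => forall i, K i x (fun j => s (pickle (i, j)))).
  move=> x s cl i; apply: (KF _).1 => N.
  (* The segment must be long enough to contain the first [N] entries of the [i]-th witness coded in
     [s]. *)
  have [x' [s' [xx' ss' Ks']]] :=
    cl (maxn N (\max_(j < N) (pickle (i, nat_of_ord j)).+1)).
  exists x', (fun j => s' (pickle (i, j))); split => //.
    exact: agree_le (leq_maxl _ _) xx'.
  move=> j jN; apply: ss'; apply: leq_trans (leq_maxr _ _).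
  exact: (leq_bigmax (F := fun j : 'I_N => (pickle (i, nat_of_ord j)).+1) (Ordinal jN)).
apply/seteqP; split => x /=; last first.
  by case=> s Ks i; rewrite (KF i).2; eexists; exact: Ks.
move=> Fx.
have /choice[s Ks] : forall i, exists s, K i x s.
  by move=> i; have := Fx i; rewrite (KF i).2.
exists (fun k => if unpickle k is Some (i, j) then s i j else 0%N) => i.
by move: (Ks i); congr (K i x); apply/funext => j; rewrite pickleK.
Qed.

Lemma analytic_and (A B : set cantor) :
  analytic A -> analytic B -> analytic [set x | A x /\ B x].
Proof.
move=> aA aB; have := @analytic_all (fun i => if i is 0%N then A else B).
have -> : [set x | forall i, (if i is 0%N then A else B) x] =
          [set x | A x /\ B x].
  apply/seteqP; split => x /=; last by case=> ? ? [].
  by move=> AB; split; [exact: (AB 0%N)|exact: (AB 1%N)].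
by apply; case.
Qed.

Lemma borel_analytic (E : set cantor) : borel E -> analytic E.
Proof.
move=> bE;
(* Carrying the complement along makes the family closed under complements. *)
suff : borel `<=` [set E | analytic E /\ analytic (~` E)] by move=> /(_ _ bE)[].
apply: smallest_sub => [|_ [k _ <-]] /=; last first.
  split; first exact: analytic_coord_eq.
  have := analytic_coord_eq k false.
  by congr analytic; apply/seteqP; split => x /=; [move=> ->|move/negP/negbTE].
split=> [|A|A] /=.
- split.
    exists (fun _ _ => False) => [x s /(_ 0%N)[? [? []]] //|].
    by apply/seteqP; split => x //= -[].
  exists (fun _ _ => True) => //.
  by apply/seteqP; split => [x _|x _ []]; exists id.
- by rewrite setTD setCK => -[].
- move=> aA; split.
    have := analytic_ex (fun i => (aA i).1).
    by congr analytic; apply/seteqP; split => x /= [i]; exists i.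
  have := analytic_all (fun i => (aA i).2).
  congr analytic; apply/seteqP; split => x /=.
    by move=> nA [i _ /nA].
  by move=> nA i Ai; apply: nA; exists i.
Qed.

Lemma analytic_proj (E : set cantor) : analytic E -> analytic (proj E).
Proof.
move=> [K cK ->].
(* Each entry of [s] carries a bit of [y] as its parity and an entry of the old witness as its
   half. *)
exists (fun x s => K (join x (odd \o s)) (half \o s)).
  move=> x s cl; apply: cK => N; have [x' [s' [xx' ss' Ks']]] := cl N.
  exists (join x' (odd \o s')), (half \o s'); split => // i iN.
    have iN2 : (i./2 < N)%N by lia.
    by rewrite /join /= xx' // ss'.
  by rewrite /= ss'.
apply/seteqP; split => x /=.
  case=> y [s Ks]; exists (fun i => (y i + (s i).*2)%N).
  have -> : odd \o (fun i => (y i + (s i).*2)%N) = y.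
    by apply/funext => i /=; rewrite oddD odd_double oddb addbF.
  suff -> : half \o (fun i => (y i + (s i).*2)%N) = s by [].
  by apply/funext => i /=; rewrite half_bit_double.
by case=> s Ks; exists (odd \o s), (half \o s).
Qed.

Definition separable (P Q : set cantor) :=
  exists B, [/\ borel B, P `<=` B & forall x, B x -> ~ Q x].

(** Used in contrapositive form: if two countable unions are not separable, then some pair of their
    pieces is not. *)
Lemma separable_union (I : countType) (P Q : I -> set cantor) :
  (forall i j, separable (P i) (Q j)) ->
  separable [set x | exists i, P i x] [set x | exists i, Q i x].
Proof.
move=> sPQ.
have /choice[B BP] : forall ij : I * I, exists B,
    [/\ borel B, P ij.1 `<=` B & forall x, B x -> ~ Q ij.2 x].
  by move=> -[i j]; exact: sPQ.
exists [set x | exists i, forall j, B (i, j) x]; split.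
- apply: (sa_ex borel_sigma_algebra) => i; apply: (sa_all borel_sigma_algebra) => j.
  by case: (BP (i, j)).
- by move=> x [i Pi]; exists i => j; case: (BP (i, j)) => _ + _; apply.
- by move=> x [i Bi] [j]; case: (BP (i, j)) => _ _; apply.
Qed.

(* Lusin's separation theorem. If the sets were not separable, then neither
   would be a pair of pieces with the same initial segment of x, and the limit
   of the nested pieces would be a common point. *)
Lemma analytic_separable (P Q : set cantor) :
  analytic P -> analytic Q -> (forall x, P x -> ~ Q x) -> separable P Q.
Proof.
move=> [K cK ->] [L cL ->] PQ; apply: contrapT => nsep.
(* An entry holds a bit of the common point, an entry of a witness for [P] and one of a witness for
   [Q]. Stage [N] reads the first [N] entries only. *)
pose node := (nat -> bool * nat * nat)%type.
pose PN N (f : node) := [set x | agree N (fun i => (f i).1.1) x /\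
  exists2 s, agree N (fun i => (f i).1.2) s & K x s].
pose QN N (f : node) := [set x | agree N (fun i => (f i).1.1) x /\
  exists2 s, agree N (fun i => (f i).2) s & L x s].
pose bad N f := ~ separable (PN N f) (QN N f).
pose upd (f : node) N a : node := fun i => if i == N then a else f i.
have upd_agree N f a (T : Type) (h : bool * nat * nat -> T) (g : nat -> T) :
    agree N (fun i => h (f i)) g -> h a = g N ->
    agree N.+1 (fun i => h (upd f N a i)) g.
  move=> fg ag i; rewrite ltnS leq_eqVlt /upd; case: eqP => [-> //|_ /= iN].
  exact: fg.
have step N f : bad N f -> exists a, bad N.+1 (upd f N a).
  move=> bN; apply: contrapT => nex; apply: bN.
  have all_sep a : separable (PN N.+1 (upd f N a)) (QN N.+1 (upd f N a)).
    by apply: contrapT => na; apply: nex; exists a.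
  (* Both pieces are cut by the bit [x N] and the next witness entry; [0] fills the component that
     the piece ignores. *)
  pose Pi (i : bool * nat) := [set x | PN N f x /\ x N = i.1 /\
    exists2 s, agree N.+1 (fun j => (upd f N (i, 0%N) j).1.2) s & K x s].
  pose Qi (i : bool * nat) := [set x | QN N f x /\ x N = i.1 /\
    exists2 s, agree N.+1 (fun j => (upd f N (i.1, 0%N, i.2) j).2) s & L x s].
  have -> : PN N f = [set x | exists i, Pi i x].
    apply/seteqP; split => x /=; last by case=> i [].
    move=> PNx; case: (PNx) => xz [s fs Ks].
    exists (x N, s N); split => //; split => //; exists s => //.
    exact: (@upd_agree _ _ _ _ (fun a => a.1.2)).
  have -> : QN N f = [set x | exists i, Qi i x].
    apply/seteqP; split => x /=; last by case=> i [].
    move=> QNx; case: (QNx) => xz [s fs Ls].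
    exists (x N, s N); split => //; split => //; exists s => //.
    exact: (@upd_agree _ _ _ _ (fun a => a.2)).
  apply: separable_union => -[b m] [b' m'].
  (* Pieces with different bits at [N] are separated by that bit; equal bits give an extension of
     the node. *)
  have [<-|bb'] := eqVneq b b'; last first.
    exists [set x | x N = b]; split; first exact: borel_coord_eq.
      by move=> x [_ []].
    by move=> x /= xb [_ [/= xb' _]]; move: bb'; rewrite -xb -xb' eqxx.
  have [B [bB PB BQ]] := all_sep (b, m, m').
  exists B; split => //.
    move=> x [[xz _] [/= xN [s fs Ks]]]; apply: PB; split.
      exact: (@upd_agree _ _ _ _ (fun a => a.1.1)).
    by exists s => // i iN; rewrite -fs // /upd; case: eqP.
  move=> x /BQ nQ [[xz _] [/= xN [s fs Ls]]]; apply: nQ; split.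
    exact: (@upd_agree _ _ _ _ (fun a => a.1.1)).
  by exists s => // i iN; rewrite -fs // /upd; case: eqP.
have [F0 bF0] : exists f, bad 0%N f.
  exists (fun=> (true, 0%N, 0%N)) => -[B [bB PB BQ]]; apply: nsep; exists B; split => //.
    by move=> x [s Ks]; apply: PB; split => //; exists s.
  by move=> x /BQ nQ [s Ls]; apply: nQ; split => //; exists s.
have /choice[a aP] : forall Nf : nat * node, exists a,
    bad Nf.1 Nf.2 -> bad Nf.1.+1 (upd Nf.2 Nf.1 a).
  move=> -[N f]; have [/step[a ba]|nb] := pselect (bad N f).
    by exists a.
  by exists (true, 0%N, 0%N).
pose F := fix F N := if N is N'.+1 then upd (F N') N' (a (N', F N')) else F0.
have badF N : bad N (F N) by elim: N => //= N IH; exact: (aP (N, F N)).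
have FM N M : (N <= M)%N -> agree N (F M) (F N).
  elim: M => [|M IH] NM i iN; first by have -> : N = 0%N by lia.
  move: NM; rewrite leq_eqVlt => /orP[/eqP -> //|NM] /=.
  rewrite /upd ifF; last by lia.
  exact: IH.
(* Entry [i] no longer changes from stage [i.+1] on. *)
pose f i := F i.+1 i.
have Ff N : agree N (F N) f by move=> i iN; exact: FM.
(* An empty piece would be separated by [set0] or [setT]. *)
have ne N : (exists x, PN N (F N) x) /\ (exists x, QN N (F N) x).
  split; apply: contrapT => em; apply: (badF N).
    exists set0; split=> [|x Px|//]; first by case: borel_sigma_algebra.
    by apply: em; exists x.
  exists setT; split=> [|//|x _ Qx].
    by have := sa_prop borel_sigma_algebra True; congr borel; apply/seteqP; split.
  by apply: em; exists x.
apply: (PQ (fun i => (f i).1.1)).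
  exists (fun i => (f i).1.2); apply: cK => N.
  have [[x [xz [s fs Ks]]] _] := ne N.
  by exists x, s; split => // i iN; rewrite -?xz -?fs // (Ff N i iN).
exists (fun i => (f i).2); apply: cL => N.
have [_ [x [xz [s fs Ks]]]] := ne N.
by exists x, s; split => // i iN; rewrite -?xz -?fs // (Ff N i iN).
Qed.

Lemma analytic_ex_count (I : countType) (F : I -> set cantor) :
  (forall i, analytic (F i)) -> analytic [set x | exists i, F i x].
Proof.
move=> aF; pose G n := if unpickle n is Some i then F i else set0.
have -> : [set x | exists i, F i x] = [set x | exists n, G n x].
  apply/seteqP; split => x /=.
    by case=> i Fi; exists (pickle i); rewrite /G pickleK.
  by case=> n; rewrite /G; case: unpickle => // i Fi; exists i.
apply: analytic_ex => n; rewrite /G; case: unpickle => //.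
by apply: borel_analytic; case: borel_sigma_algebra.
Qed.

(** * Projections of Borel sets with finite sections *)

Definition slice (E : set cantor) k b := [set z | E z /\ odds z k = b].

Definition over (E B : set cantor) := [set z | E z /\ B (evens z)].

Lemma borel_slice E k b : borel E -> borel (slice E k b).
Proof.
move=> bE; apply: (sa_and borel_sigma_algebra) => //.
exact: (borel_coord_eq k.*2.+1).
Qed.

Lemma borel_over E B : borel E -> borel B -> borel (over E B).
Proof.
move=> bE bB; apply: (sa_and borel_sigma_algebra) => //.
apply: (borel_preimage borel_sigma_algebra) bB => k; exact: (borel_coord k.*2).
Qed.

Lemma borel_proj_analytic E : borel E -> analytic (proj E).
Proof. by move=> /borel_analytic/analytic_proj. Qed.

(* The k-th bit of the point y above x is read off a Borel set separating the x
   for which this bit is 1 from those for which it is 0. *)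
Lemma borel_proj_functional E : borel E ->
  (forall x y y', E (join x y) -> E (join x y') -> y = y') -> borel (proj E).
Proof.
move=> bE Efun.
have /choice[B BP] : forall k, separable (proj (slice E k true)) (proj (slice E k false)).
  move=> k; apply: analytic_separable;
    [exact: borel_proj_analytic (borel_slice _ _ bE)..|].
  move=> x [y [Ey yk]] [y' [Ey' y'k]].
  by move: yk y'k; rewrite (Efun _ _ _ Ey Ey') => ->.
pose g x : cantor := fun k => `[< B k x >].
suff -> : proj E = [set x | E (join x (g x))].
  apply: (borel_join borel_sigma_algebra) => // k; first exact: borel_coord.
  have [+ _ _] := BP k; congr borel; by apply/seteqP; split => x /asboolP.
apply/seteqP; split => x /=; last by exists (g x).
case=> y Ey; suff -> : g x = y by [].
apply/funext => k; have [_ PB BQ] := BP k.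
case yk : (y k); apply/asboolP.
  by apply: PB; exists y; split; rewrite // odds_join.
by move/BQ; apply; exists y; split; rewrite // odds_join.
Qed.

(* Sufficient condition for the section of E above x to have more than n points. *)
Fixpoint many n (E : set cantor) : set cantor :=
  if n is m.+1 then
    [set x | exists kb : nat * bool,
      many m (slice E kb.1 kb.2) x /\ proj (slice E kb.1 (~~ kb.2)) x]
  else proj E.

Lemma many_analytic n E : borel E -> analytic (many n E).
Proof.
elim: n E => [|n IH] E bE; first exact: borel_proj_analytic.
apply: analytic_ex_count => -[k b] /=; apply: analytic_and.
  exact: IH (borel_slice _ _ bE).
exact: borel_proj_analytic (borel_slice _ _ bE).
Qed.

(** Passing to [over E B] keeps or deletes whole sections, so a [B] disjoint from [many n E] leaves
    only sections to which an induction hypothesis applies. *)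
Lemma many_over n E B x : many n (over E B) x -> many n E x /\ B x.
Proof.
elim: n E => [|n IH] E /=.
  by case=> y [Ey]; rewrite evens_join; split => //; exists y.
case=> -[k b] /= [mE [y [[Ey By] yk]]].
have sliceE : slice (over E B) k b = over (slice E k b) B.
  by apply/seteqP; split => z /= [[? ?] ?].
move: mE; rewrite sliceE => /IH[mE Bx]; split => //; exists (k, b); split => //.
by exists y.
Qed.

Lemma many_points n E x : many n E x -> exists f : nat -> cantor,
  (forall i, (i <= n)%N -> E (join x (f i))) /\
  (forall i j, (i <= n)%N -> (j <= n)%N -> f i = f j -> i = j).
Proof.
elim: n E => [|n IH] E /=.
  by case=> y Ey; exists (fun=> y); split => // -[|//] [|//].
case=> -[k b] /= [/IH[f [Ef finj]] [y [Ey yk]]].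
rewrite odds_join in yk.
(* The new point [y] differs from all the earlier ones at bit [k]. *)
have fk i : (i <= n)%N -> f i k = b by move=> /Ef[_]; rewrite odds_join.
exists (fun i => if i == n.+1 then y else f i); split.
  by move=> i; case: eqP => [//|/eqP ni ni']; apply: (Ef i _).1; lia.
move=> i j; case: eqP => [-> _|/eqP ni ni']; case: eqP => [-> //|/eqP nj nj'].
- move=> yf; have : f j k = b by apply: fk; lia.
  by rewrite -yf yk; case: b {Ef fk yk Ey}.
- move=> _ fy; have : f i k = b by apply: fk; lia.
  by rewrite fy yk; case: b {Ef fk yk Ey}.
- by apply: finj; lia.
Qed.

(* Separation shows, by induction on n, that the sets of points whose section
   contains two points with distinct k-th bits are Borel; outside of all of them
   the section has at most one point. *)
Lemma borel_proj n E : borel E -> (forall x, ~ many n E x) -> borel (proj E).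
Proof.
have bS := borel_sigma_algebra.
elim: n E => [|n IH] E bE few.
  have -> : proj E = set0 by apply/seteqP; split => x // /few.
  by case: bS.
pose Q k := [set x | proj (slice E k false) x /\ proj (slice E k true) x].
have bQ k : borel (Q k).
  (* [B b] contains every [x] with a point in the opposite slice, and misses those for which slice
     [b] satisfies [many n]. *)
  have /choice[B BP] : forall b,
      separable (proj (slice E k (~~ b))) (many n (slice E k b)).
    move=> b; apply: analytic_separable.
    - exact: borel_proj_analytic (borel_slice _ _ bE).
    - exact: many_analytic (borel_slice _ _ bE).
    - by move=> x px mx; apply: (few x); exists (k, b).
  have bR b : borel (proj (over (slice E k b) (B b))).
    have [bB _ Bm] := BP b.
    apply: IH => [|x /many_over[mx /Bm]//].
    by apply: borel_over => //; exact: borel_slice.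
  (* A point of [Q k] has both slices nonempty, hence lies in both separators, and restricting to
     them loses nothing. *)
  have := sa_and bS (bR false) (bR true); congr borel; apply/seteqP; split => x /=.
    by move=> [[y [Ey _]] [y' [Ey' _]]]; split; [exists y|exists y'].
  move=> [p0 p1]; have [_ /(_ _ p1) B0 _] := BP false.
  have [_ /(_ _ p0) B1 _] := BP true.
  case: p0 p1 => y Ey [y' Ey'].
  by split; [exists y|exists y']; split; rewrite // evens_join.
pose U := [set x | exists k, Q k x].
have bU : borel U by exact: sa_ex.
have -> : proj E = [set x | U x \/ proj (over E [set x | ~ U x]) x].
  apply/seteqP; split => x /=.
    case=> y Ey; have [Ux|nUx] := pselect (U x); [by left|right].
    by exists y; split; rewrite //= evens_join.
  by case=> [[k [[y [Ey _]] _]]|[y [Ey _]]]; exists y.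
apply: (sa_or bS bU); apply: borel_proj_functional.
  by apply: borel_over => //; exact: sa_not bS _ bU.
move=> x y y' [Ey nU] [Ey' _]; apply/funext => k.
rewrite /= evens_join in nU; apply: contrapT => yy'; apply: nU; exists k.
case yk : (y k); case y'k : (y' k); rewrite yk y'k // in yy'; split.
- by exists y'; split; rewrite // odds_join.
- by exists y; split; rewrite // odds_join.
- by exists y; split; rewrite // odds_join.
- by exists y'; split; rewrite // odds_join.
Qed.

(** * Standard Borel spaces as Borel subsets of the Cantor space *)

Section PolishCoding.
Variables (R : realType) (M : metricType R).
Hypothesis Mcomplete :
  forall u : nat -> M, cauchy (u @ \oo) -> exists l : M, u @ \oo --> l.
Variables (Q : set M) (Qdense : dense Q).
Variables (e : M -> nat) (einj : {in Q &, injective e}).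

(* Empty when k is not the code of a ball. *)
Let U k : set M :=
  [set v | exists q (m : nat), [/\ Q q, k = pickle (e q, m) & ball q m.+1%:R^-1 v]].

Let phi (v : M) : cantor := fun k => `[< U k v >].

Let open_mball (x : M) (r : R) : open (ball x r).
Proof.
rewrite openE => y; rewrite ballEmdist /= => xy; apply/nbhs_ballP.
exists (r - mdist x y) => [|z]; first by rewrite /= subr_gt0.
by rewrite ballEmdist /= => yz; have := metric_triangle x y z; lra.
Qed.

Let U_open k : open (U k).
Proof.
rewrite openE => v [q [m [Qq km qv]]].
have := open_mball q m.+1%:R^-1; rewrite openE => /(_ v qv).
by apply: filterS => w qw; exists q, m.
Qed.

Let U_ball q m v : Q q -> U (pickle (e q, m)) v -> ball q m.+1%:R^-1 v.
Proof.
move=> Qq [q' [m' [Qq' /(pcan_inj pickleK)[eqq' ->]]]].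
by have -> : q = q' by apply: einj; rewrite ?inE.
Qed.

Let U_cover m v : exists2 q, Q q & ball q m.+1%:R^-1 v.
Proof.
have m0 : 0 < m.+1%:R^-1 :> R by rewrite invr_gt0.
have [q [vq Qq]] := Qdense (ex_intro _ v (ballxx v m0)) (open_mball v _).
by exists q => //; exact: ball_sym.
Qed.

Let U_basis (O : set M) v : open O -> O v -> exists k, U k v /\ closure (U k) `<=` O.
Proof.
move=> oO Ov; have /nbhs_ballP[d /= d0 dO] : nbhs v O by exact: open_nbhs_nbhs.
(* The distance from [v] to [w] is split at the centre [q] and at a point [w'] of the ball near
   [w]. *)
have d30 : 0 < d / 3 by rewrite divr_gt0.
have [m _ /(_ m (leqnn m)) md] := near_infty_natSinv_lt (PosNum d30).
rewrite /= in md.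
have [q Qq qv] := U_cover m v.
exists (pickle (e q, m)); split; first by exists q, m.
move=> w clw; apply: dO.
have [w' [/U_ball-/(_ Qq) Uw' ww']] := clw _ (nbhsx_ballx w _ d30).
have vq : ball v (d / 3) q by apply: ball_sym; exact: (le_ball (ltW md)) qv.
have qw' : ball q (d / 3) w' by exact: (le_ball (ltW md)) Uw'.
have -> : d = d / 3 + d / 3 + d / 3 by lra.
exact: ball_triangle (ball_triangle vq qw') (ball_sym ww').
Qed.

(* A code z comes from a point iff its finite initial segments do, it selects
   arbitrarily small balls, and each U k it selects contains the closure of
   another one; the last clause keeps the limit point inside U k. *)
Let phi_range : range phi = [set z |
  (forall N, exists t : seq bool,
     (exists v, agree N (phi v) (nth false t)) /\ agree N z (nth false t)) /\
  ((forall m : nat, exists j : nat, z (pickle (j, m))) /\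
   (forall k, exists k', z k = false \/ (closure (U k') `<=` U k /\ z k')))].
Proof.
apply/seteqP; split => z /=.
  case=> v _ <-{z}; split; last split.
  - move=> N; exists (mkseq (phi v) N).
    by split; [exists v|] => i iN; rewrite nth_mkseq.
  - move=> m; have [q Qq qv] := U_cover m v.
    by exists (e q); apply/asboolP; exists q, m.
  - move=> k; case vk : (phi v k); last by exists 0%N; left.
    have [k' [Uv cU]] := U_basis (U_open k) (asboolW vk).
    by exists k'; right; split => //; exact/asboolP.
case=> approx [small regular].
have /choice[v vP] : forall N, exists v, agree N (phi v) z.
  move=> N; have [t [[v vt] zt]] := approx N.
  by exists v => i iN; rewrite vt // zt.
have zU k N : z k -> (k < N)%N -> U k (v N).
  by move=> zk kN; apply/asboolP; rewrite -[asbool _]/(phi (v N) k) vP.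
(* Each ball selected by [z] contains all [v N] from some stage on, and these balls have arbitrarily
   small radii. *)
have [l vl] : exists l : M, v @ \oo --> l.
  apply: Mcomplete; apply: cauchy_exP => d d0.
  have [m _ /(_ m (leqnn m)) md] := near_infty_natSinv_lt (PosNum d0).
  rewrite /= in md; have [j zj] := small m.
  have [q [m' [Qq jq _]]] := zU _ _ zj (ltnSn _).
  exists q; exists (pickle (j, m)).+1 => // N /= jN.
  apply: (le_ball (ltW md)); apply: U_ball => //.
  by move: (zU _ _ zj jN); case/(pcan_inj pickleK): jq => -> _.
exists l => //; apply/funext => k; case zk : (z k); apply/asboolP.
  have [k' [|[cU zk']]] := regular k; first by rewrite zk.
  apply: cU => B /vl [N _ NB]; exists (v (maxn N k'.+1)); split.
    by apply: zU => //; exact: leq_maxr.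
  by apply: NB; exact: leq_maxl.
(* If the open set [U k] contained the limit, it would contain late [v N], whose codes agree with
   [z] at [k]. *)
move=> Ul; have [N _ NU] := vl _ (open_nbhs_nbhs (conj (U_open k) Ul)).
have : phi (v (maxn N k.+1)) k by apply/asboolP/NU; exact: leq_maxl.
by rewrite vP ?zk //; exact: leq_maxr.
Qed.

(** The description of the range uses countable quantifiers only. The sigma-algebras match because
    coordinates pull back to the basic open sets [U k], and every open set is a countable union of
    these. *)
Lemma polish_coding : exists2 phi : M -> cantor,
  borel (range phi) & <<s @open M >> = [set phi @^-1` E | E in borel].
Proof.
have bS := borel_sigma_algebra.
have oS : sigma_algebra setT <<s @open M >> by exact: smallest_sigma_algebra.
exists phi.
  rewrite phi_range.
  have agree_borel N t : borel [set z | agree N z (nth false t)].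
    apply: (sa_all bS) => i; apply: (sa_imp bS) => _; exact: borel_coord_eq.
  apply: (sa_and bS).
    (* Finite words [t] keep the quantifier countable; that some [v] realizes [t] is a condition
       independent of [z]. *)
    apply: (sa_all bS) => N; apply: (sa_ex bS) => t.
    by apply: (sa_and bS); [exact: sa_prop|exact: agree_borel].
  apply: (sa_and bS).
    by apply: (sa_all bS) => m; apply: (sa_ex bS) => j; exact: borel_coord.
  apply: (sa_all bS) => k; apply: (sa_ex bS) => k'; apply: (sa_or bS).
    exact: borel_coord_eq.
  apply: (sa_and bS); [exact: sa_prop|exact: borel_coord].
apply/seteqP; split.
  apply: smallest_sub; first exact: sigma_algebra_preimages.
  move=> O oO; exists [set z | exists k, U k `<=` O /\ z k].
    apply: (sa_ex bS) => k; apply: (sa_and bS); [exact: sa_prop|exact: borel_coord].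
  apply/seteqP; split => v /=.
    by case=> k [+ /asboolP Uv]; apply.
  move=> Ov; have [k [Uv cU]] := U_basis oO Ov.
  exists k; split; last exact/asboolP.
  exact: subset_trans (@subset_closure _ _) cU.
move=> _ [E bE <-]; apply: (borel_preimage oS) bE => k; apply: sub_sigma_algebra.
have -> : [set v | phi v k] = U k by apply/seteqP; split => v /asboolP.
exact: U_open.
Qed.

End PolishCoding.

Lemma standard_borel_coding (R : realType) (V : Type) (S : set (set V)) :
  standard_borel R S -> exists2 psi : V -> cantor,
  borel (range psi) & S = [set psi @^-1` E | E in borel].
Proof.
move=> [M [f [[Mc [Q /countable_injP[e einj] Qd]] [g fK gK] ->]]].
have [phi phi_range ->] := polish_coding Mc Qd einj.
exists (phi \o f).
- move: phi_range; congr borel; apply/seteqP; split => z [v _ <-].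
    by exists (g v) => //=; rewrite gK.
  by exists (f v).
- apply/seteqP; split => [_ [_ [E bE <-] <-]|_ [E bE <-]]; first by exists E.
  by exists (phi @^-1` E) => //; exists E.
Qed.

(** * Borel sets of predecessors *)

Section Predecessors.
Variables (R : realType) (V : Type) (S : set (set V)).
Hypothesis hS : standard_borel R S.

Lemma standard_borel_sigma_algebra : sigma_algebra setT S.
Proof.
have [psi _ ->] := standard_borel_coding hS.
exact: sigma_algebra_preimages borel_sigma_algebra.
Qed.

Lemma borel_predecessors (D : digraph V) n (B : set V) :
  borel_digraph D S -> out_degree_le D n -> S B ->
  S [set x | exists2 y, arcs D (x, y) & B y].
Proof.
have bS := borel_sigma_algebra.
have [psi psi_range SE] := standard_borel_coding hS => Dborel Ddeg.
rewrite {1}SE => -[EB bEB EBE].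
pose h (p : V * V) := join (psi p.1) (psi p.2).
have [E bE arcsE] : [set h @^-1` E | E in borel] (arcs D).
  suff : prod_sigma_algebra S S `<=` [set h @^-1` E | E in borel] by apply.
  apply: smallest_sub; first exact: sigma_algebra_preimages.
  rewrite SE => _ [_ [E bE <-] [_ [F bF <-] <-]].
  exists [set z | E (evens z) /\ F (odds z)].
    apply: (sa_and bS).
      by apply: (borel_preimage bS) bE => k; exact: (borel_coord k.*2).
    by apply: (borel_preimage bS) bF => k; exact: (borel_coord k.*2.+1).
  by apply/seteqP; split => p; rewrite /h /= evens_join odds_join.
(* Confining both coordinates to the range of [psi] makes every point of [E'] code an arc, here one
   ending in [B]. *)
pose E' := [set z | E z /\ (range psi (evens z) /\ (range psi (odds z) /\ EB (odds z)))].
have bE' : borel E'.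
  apply: (sa_and bS) => //; apply: (sa_and bS).
    by apply: (borel_preimage bS) psi_range => k; exact: (borel_coord k.*2).
  apply: (sa_and bS).
    by apply: (borel_preimage bS) psi_range => k; exact: (borel_coord k.*2.+1).
  by apply: (borel_preimage bS) bEB => k; exact: (borel_coord k.*2.+1).
rewrite SE; exists (proj E').
  (* Otherwise [n.+1] points in the section above [psi v] would code as many out-neighbours of
     [v]. *)
  apply: (@borel_proj n) => // x /many_points[f [Ef finj]].
  have [_ [[v _ vx] _]] := Ef 0%N isT; rewrite evens_join in vx.
  have : (`I_n.+1 #<= `I_n)%card; last by rewrite card_le_II ltnn.
  have /card_eqPle[_ If] : (f @` `I_n.+1 #= `I_n.+1)%card.
    by apply: inj_card_eq => i j; rewrite !inE /= !ltnS => *; exact: finj.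
  apply: card_le_trans If _; apply: card_le_trans (Ddeg v).
  apply: card_le_trans (card_image_le psi _); apply: subset_card_le => _ [i /= iN <-].
  have [] := Ef i iN; rewrite odds_join evens_join => Ei [_ [[w _ wf] _]].
  by exists w => //=; rewrite /out_neighbours /= -arcsE /h /= vx wf.
apply/seteqP; split => x /=.
  case=> z [Ez [_ [[y _ yz] EBz]]]; rewrite odds_join in yz EBz.
  exists y; first by rewrite -arcsE /h /= yz.
  by rewrite -EBE /= yz.
case=> y xy By; exists (psi y); rewrite /E' /= evens_join odds_join.
split; first by move: xy; rewrite -arcsE.
by split; [exists x|split; [exists y|move: By; rewrite -EBE]].
Qed.

End Predecessors.

(** * Colouring *)

Section Greedy.
Variables (V : Type) (S : set (set V)) (hS : sigma_algebra setT S).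
Variables (G : V -> V -> Prop) (k : nat) (r : V -> nat).
Hypothesis r_bound : forall x, (r x < k)%N.
Hypothesis r_decr : forall x y, G x y -> (r y < r x)%N.
Hypothesis G_finite : forall x, finite_set [set y | G x y].
Hypothesis G_borel : forall B, S B -> S [set x | exists2 y, G x y & B y].

Let mex_exists (A : set nat) : finite_set A ->
  exists p, ~ A p /\ forall q, (q < p)%N -> A q.
Proof.
move=> finA.
have exA : exists p, `[< ~ A p >].
  apply: contrapT => nA; apply: infinite_nat.
  suff <- : A = setT by [].
  apply/seteqP; split => // p _; apply: contrapT => nAp; apply: nA.
  by exists p; apply/asboolP.
case: (ex_minnP exA) => p /asboolP nAp minp; exists p; split => // q qp.
by apply: contrapT => /asboolP/minp; rewrite leqNgt qp.
Qed.

(** Recolouring every vertex by the least colour missing among its [G]-successors is iterated from a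
    constant colouring. As [r] decreases along [G], the [k]-th iterate is a fixed point, which gives
    the last two properties. *)
Lemma greedy_coloring : exists h : V -> nat,
  [/\ forall p, S [set x | h x = p],
      forall x y, G x y -> h x <> h y &
      forall x p, (p < h x)%N -> exists2 y, G x y & h y = p].
Proof.
have /choice[next nextP] : forall h : V -> nat, exists h' : V -> nat, forall x,
    ~ (exists2 y, G x y & h y = h' x) /\
    forall q, (q < h' x)%N -> exists2 y, G x y & h y = q.
  move=> h.
  have /choice[h' h'P] := fun x => mex_exists (finite_image h (G_finite x)).
  by exists h'.
pose h m := iter m next (fun=> 0%N).
have next_uniq (g g' : V -> nat) x : (forall y, G x y -> g y = g' y) ->
    (next g x <= next g' x)%N.
  move=> gg'; rewrite leqNgt; apply/negP => /((nextP g x).2)[y xy gy].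
  by apply: (nextP g' x).1; exists y => //; rewrite -gg'.
have stable m x : (r x < m)%N -> h m.+1 x = h m x.
  elim: m x => // m IH x xm.
  have eq_h y : G x y -> h m.+1 y = h m y.
    by move=> /r_decr yx; apply: IH; lia.
  by apply/eqP; rewrite eqn_leq !next_uniq // => y /eq_h.
have hE x : next (h k) x = h k x by exact: stable.
exists (h k); split.
(* A vertex gets colour [p] iff the previous iterate uses every [q < p], but not [p], on its
   successors. *)
- elim: k => [|m IH] p; first exact: (sa_prop hS (0%N = p)).
  have := sa_and hS (sa_not hS (G_borel (IH p)))
    (sa_all hS (fun q => sa_imp hS (fun _ : (q < p)%N => G_borel (IH q)))).
  congr S; apply/seteqP; split => x /=; last first.
    by move=> <-; exact: nextP.
  move=> [np qp]; apply/eqP; rewrite eqn_leq; apply/andP; split;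
    rewrite leqNgt; apply/negP.
    by move=> /((nextP (h m) x).2).
  by move=> /qp; exact: (nextP (h m) x).1.
- by move=> x y xy hxy; apply: (nextP (h k) x).1; exists y; rewrite ?hE.
- by move=> x p; rewrite -hE => /((nextP _ x).2).
Qed.

End Greedy.

(** This is the Cantor pairing: pairs with sum [s] fill the [s.+1] consecutive numbers from
    ['C(s.+1, 2)] on, so different sums give disjoint blocks. *)
Lemma triangular_pairing_inj i j i' j' :
  ('C((i + j).+1, 2) + j = 'C((i' + j').+1, 2) + j')%N -> i = i' /\ j = j'.
Proof.
have lt (a b c d : nat) : (a + b < c + d)%N ->
    ('C((a + b).+1, 2) + b < 'C((c + d).+1, 2) + d)%N.
  move=> abcd; have := leq_bin2l 2 (abcd : ((a + b).+2 <= (c + d).+1)%N).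
  by rewrite binS bin1; lia.
have [/lt|/lt|e] := ltngtP (i + j)%N (i' + j')%N; try lia.
by rewrite e => /addnI; lia.
Qed.

Lemma triangular_pairing_lt i j n :
  (i + j <= n)%N -> ('C((i + j).+1, 2) + j < 'C(n.+2, 2))%N.
Proof.
move=> ijn; have := leq_bin2l 2 (ijn : ((i + j).+2 <= n.+2)%N).
by rewrite binS bin1; lia.
Qed.

Lemma borel_coloring_bound (R : realType) (V : Type) (S : set (set V))
    (D : digraph V) n k :
  standard_borel R S -> borel_digraph D S -> out_degree_le D n ->
  borel_colorable S (underlying D) k -> borel_colorable S (underlying D) 'C(n.+2, 2).
Proof.
move=> sbS bD degD [c [cS cadj]].
have hS := standard_borel_sigma_algebra sbS.
have pre B : S B -> S [set x | exists2 y, arcs D (x, y) & B y].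
  exact: (borel_predecessors sbS).
have finD x : finite_set (out_neighbours D x) by apply/finite_set_leP; exists n.
(* Splitting by the colour [i] of [x] turns the relation between colours into a condition on [y]
   alone. *)
have pre_rel (rel : 'I_k -> 'I_k -> bool) B : S B ->
    S [set x | exists2 y, arcs D (x, y) /\ rel (c x) (c y) & B y].
  move=> SB; have := sa_ex hS (fun i : 'I_k => sa_and hS (cS [set i])
    (pre _ (sa_and hS (cS [set j | rel i j]) SB))).
  congr S; apply/seteqP; split => x /=.
    by move=> [i [<- [y xy [ry By]]]]; exists y.
  by move=> [y [xy ry] By]; exists (c x); split => //; exists y.
have fin_rel (rel : 'I_k -> 'I_k -> bool) x :
    finite_set [set y | arcs D (x, y) /\ rel (c x) (c y)].
  by apply: sub_finite_set (finD x) => y [].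
(* Forward arcs raise [c], so the rank is counted down from the top colour [k.-1]. *)
have [hf [hfS hfadj hfmex]] := @greedy_coloring _ _ hS
  (fun x y => arcs D (x, y) /\ (c x < c y)%N) k (fun x => k.-1 - c x)%N
  ltac:(move=> x; have := ltn_ord (c x); lia)
  ltac:(move=> x y [_]; have := ltn_ord (c y); lia)
  (fin_rel (fun i j => i < j)%N) (pre_rel (fun i j => i < j)%N).
have [hb [hbS hbadj hbmex]] := @greedy_coloring _ _ hS
  (fun x y => arcs D (x, y) /\ (c y < c x)%N) k (fun x => c x)
  ltac:(by move=> x; exact: ltn_ord)
  ltac:(by move=> x y [])
  (fin_rel (fun i j => j < i)%N) (pre_rel (fun i j => j < i)%N).
have hfb x : (hf x + hb x <= n)%N.
  (* Indices below [hf x] go to forward out-neighbours, the next [hb x] to backward ones. The two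
     kinds are disjoint, so [f] is injective there; later indices get the default [x]. *)
  have /choice[f fP] : forall i, exists y, (i < hf x + hb x)%N ->
      if (i < hf x)%N then (arcs D (x, y) /\ (c x < c y)%N) /\ hf y = i
      else (arcs D (x, y) /\ (c y < c x)%N) /\ (hb y + hf x)%N = i.
    move=> i; have [ifx|fxi] := ltnP i (hf x).
      by have [y ? ?] := hfmex x i ifx; exists y.
    have [ib|bi] := ltnP i (hf x + hb x)%N; last by exists x; lia.
    have [|y ? hy] := hbmex x (i - hf x)%N; first by lia.
    by exists y => _; split => //; lia.
  rewrite -card_le_II; apply: card_le_trans (degD x).
  have /card_eqPle[_ If] : (f @` `I_(hf x + hb x) #= `I_(hf x + hb x))%card.
    apply: inj_card_eq => i j; rewrite !inE /= => /fP Pi /fP Pj fij.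
    move: Pi Pj; rewrite fij.
    by case: ifP => _ [[_ ci] hi]; case: ifP => _ [[_ cj] hj]; lia.
  apply: card_le_trans If _; apply: subset_card_le => _ [i /= /fP + <-].
  by case: ifP => _ [[]].
pose code i j := ('C((i + j).+1, 2) + j)%N.
have code_lt x : (code (hf x) (hb x) < 'C(n.+2, 2))%N.
  exact: triangular_pairing_lt.
exists (fun x => Ordinal (code_lt x)); split.
  move=> Y.
  (* The preimage of [Y] is a countable union over the pairs of values whose code lies in [Y]. *)
  have := sa_ex hS (fun ij : nat * nat => sa_and hS (sa_and hS (hfS ij.1) (hbS ij.2))
    (sa_prop hS (exists2 l, Y l & nat_of_ord l = code ij.1 ij.2))).
  congr S; apply/seteqP; split => x /=.
    move=> [[i j] /= [[<- <-] [l Yl le]]]; suff -> : Ordinal (code_lt x) = l by [].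
    exact: val_inj.
  by move=> Yx; exists (hf x, hb x); split => //; exists (Ordinal (code_lt x)).
have proper x y : arcs D (x, y) -> Ordinal (code_lt x) <> Ordinal (code_lt y).
  move=> xy /(congr1 val)/= /triangular_pairing_inj[ef eb].
  have cxy : c x <> c y by apply: cadj; left.
  have [lt|lt|/val_inj//] := ltngtP (c x) (c y).
    exact: (hfadj x y).
  exact: (hbadj x y).
by move=> x y [/proper//|/proper + /esym].
Qed.

Theorem theorem1p1 (R : realType) (n : nat) (hn : (1 <= n)%N)
    (V : Type) (S : set (set V)) (hS : standard_borel R S)
    (D : digraph V) (hB : borel_digraph D S)
    (hlc : locally_countable D) (hdeg : out_degree_le D n) :
  borel_chromatic_number S (underlying D) R = +oo%E \/
  (borel_chromatic_number S (underlying D) R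
     <= ((n%:R + 1) * (n%:R + 2) / 2)%:E)%E.
Proof.
rewrite /borel_chromatic_number; case: pselect => [colorable|_]; [right|by left].
case: ex_minnP => k /asboolP ck kmin.
have /asboolP/kmin le_k := borel_coloring_bound hS hB hdeg ck.
rewrite lee_fin; apply: (@le_trans _ _ 'C(n.+2, 2)%:R); first by rewrite ler_nat.
(* This is [(n + 2)(n + 1) = 2 'C(n.+2, 2)]. *)
have := mul_bin_diag n.+2 1; rewrite bin1 => /(congr1 (fun m => m%:R : R)).
by rewrite !natrM -(natr1 n.+1) -(natr1 n) => E; lra.
Qed.
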